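(* Let $r\ge2$, $1\le l\le r$, let $d_1,\dots,d_r\ge2$ be integers, and let $(\alpha_1,\dots,\alpha_l)$ be a rational point with nonzero entries on the ellipsoid $d_1\alpha_1^2+\dots+d_l\alpha_l^2=4$. Consider the system $$\dot x_j=-2x_ju_j,\quad \dot u_j=-u_ju_{r+1}+\tfrac1{d_j}x_j\quad(1\le j\le r),\qquad \dot x_{r+1}=x_{r+1}u_{r+1},\quad \dot u_{r+1}=-\sum_{k=1}^rd_ku_k^2 .$$ Let $Q=\gcd\{\alpha_1,\dots,\alpha_l,2\}$ and consider the associated series expansions $$x_j=\sum_{i\ge0}a_{j,i}t^{\alpha_j+iQ},\ u_j=\sum_{i\ge0}c_{j,i}t^{-1+iQ}\ (1\le j\le l);\qquad x_j=\sum_{i\ge0}a_{j,i}t^{iQ},\ u_j=\sum_{i\ge0}c_{j,i}t^{1+iQ}\ (l+1\le j\le r);$$ $$x_{r+1}=\sum_{i\ge0}b_it^{1+iQ},\qquad u_{r+1}=\sum_{i\ge0}e_it^{-1+iQ},$$ with $c_{j,0}=-\alpha_j/2$ for $1\le j\le l$, $c_{j,0}=a_{j,0}/(2d_j)$ for $l+1\le j\le r$, and $e_0=1$. Then these expansions satisfy the compatibility conditions at the top resonance $iQ=2$ for any choice of (nonzero complex) leading coefficients $a_{j,0}$ ($1\le j\le r$) and $b_0$. Furthermore, the free parameter at the top resonance can be chosen so that the solution lies on the set $H=0$.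
   Context: $Q=\gcd\{\alpha_1,\dots,\alpha_l,2\}$ is the largest positive rational number of which $\alpha_1,\dots,\alpha_l,2$ are all integer multiples; define integers $s_j$ by $\alpha_j=-2+s_jQ$ ($1\le j\le l$), and write $\iota=iQ$. Coefficients $a_{j,k}$ with $k<0$ are zero. Substituting the expansions gives, for each $i\ge1$, the following linear system in the step-$i$ unknowns $(a_{j,i})_j,b_i,(c_{j,i})_j,e_i$: - for $1\le j\le l$: $\ \iota\,a_{j,i}+2a_{j,0}c_{j,i}=-2\sum_{k=1}^{i-1}a_{j,i-k}c_{j,k}$ and $\iota\,c_{j,i}+c_{j,0}e_i=-\sum_{k=1}^{i-1}c_{j,i-k}e_k+d_j^{-1}a_{j,i-s_j}$; - for $l+1\le j\le r$: $\ \iota\,a_{j,i}=-2\sum_{k=0}^{i-2/Q}a_{j,i-2/Q-k}c_{j,k}$ and $-d_j^{-1}a_{j,i}+(\iota+2)c_{j,i}+c_{j,0}e_i=-\sum_{k=1}^{i-1}c_{j,i-k}e_k$; - $\iota\,b_i-b_0e_i=\sum_{k=1}^{i-1}b_{i-k}e_k$; - $2\sum_{j=1}^ld_jc_{j,0}c_{j,i}+(\iota-1)e_i=-\sum_{j=1}^ld_j\sum_{k=1}^{i-1}c_{j,i-k}c_{j,k}-\sum_{j=l+1}^rd_j\sum_{k=0}^{i-4/Q}c_{j,i-4/Q-k}c_{j,k}$. Let $X(\iota)$ be the coefficient matrix of the left-hand sides. Resonances are the values of $\iota$ with $\det X(\iota)=0$; the largest is $\iota=2$. The compatibility conditions there hold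 if the right-hand side at step $i=2/Q$, computed from the previous steps, lies in the image of $X(2)$. The free parameter at the top resonance is the parameter of the (one-dimensional affine) solution space of the linear system at step $i=2/Q$. Here $H=-x_{r+1}\big(\sum_{k=1}^rd_ku_k^2-u_{r+1}^2+\sum_{k=1}^rx_k+1\big)$, and lying on $H=0$ means that the factor in parentheses vanishes identically as a formal series. *)

(* Defs.v *)
From mathcomp Require Import all_boot all_order all_algebra.
From mathcomp Require Import reals complex.

Set Implicit Arguments.
Unset Strict Implicit.
Unset Printing Implicit Defensive.

Import Order.TTheory GRing.Theory Num.Theory.
Local Open Scope ring_scope.

(* Throughout, the indices 1, .., r are the elements of 'I_r, and the range    *)
(* 1 <= j <= l is (j < l)%N. Only the values of alpha : 'I_r -> rat (and of    *)
(* s : 'I_r -> int) at indices j < l are ever used.                            *)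

Definition int_multiple (x Q : rat) : Prop := exists z : int, x = z%:~R * Q.

Definition common_step (r l : nat) (alpha : 'I_r -> rat) (Q : rat) : Prop :=
  [/\ 0 < Q, forall j : 'I_r, (j < l)%N -> int_multiple (alpha j) Q
    & int_multiple 2 Q].

(* Q = gcd {alpha_1, .., alpha_l, 2} *)
Definition is_gcd_step (r l : nat) (alpha : 'I_r -> rat) (Q : rat) : Prop :=
  common_step l alpha Q /\ forall Q', common_step l alpha Q' -> Q' <= Q.

(* The formal series \sum_(i >= 0) fs_coef i * t ^ (fs_exp + i Q), for a step  *)
(* Q which is a parameter of the operations below. Since different series may  *)
(* start at different exponents, identities between series are stated          *)
(* coefficientwise, through fs_at.                                             *)
Record fseries (C : Type) := FSeries { fs_exp : rat; fs_coef : nat -> C }.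

Section FormalSeries.
Variables (C : fieldType) (Q : rat).

(* the coefficient of t ^ q *)
Definition fs_at (f : fseries C) (q : rat) : C :=
  let m := (q - fs_exp f) / Q in
  if m \is a Num.nat then fs_coef f (Num.truncn m) else 0.

Definition fs_one : fseries C := FSeries 0 (fun i => (i == 0%N)%:R).

Definition fs_deriv (f : fseries C) : fseries C :=
  FSeries (fs_exp f - 1) (fun i => ratr (fs_exp f + i%:R * Q) * fs_coef f i).

Definition fs_mul (f g : fseries C) : fseries C :=
  FSeries (fs_exp f + fs_exp g)
    (fun i => \sum_(0 <= k < i.+1) fs_coef f (i - k)%N * fs_coef g k).

End FormalSeries.

Arguments fs_one {C}.

(* The coefficients a_{j,i}, b_i, c_{j,i}, e_i. *)
Record coefs (C : Type) (r : nat) := Coefs {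
  ca : 'I_r -> nat -> C;
  cb : nat -> C;
  cc : 'I_r -> nat -> C;
  ce : nat -> C
}.

Section Expansions.
Variables (C : fieldType) (r l : nat) (d : 'I_r -> nat) (alpha : 'I_r -> rat).
Variable Q : rat.

Implicit Types (S : coefs C r) (j : 'I_r).

Definition ser_x S j : fseries C :=
  FSeries (if (j < l)%N then alpha j else 0) (ca S j).
Definition ser_u S j : fseries C :=
  FSeries (if (j < l)%N then -1 else 1) (cc S j).
Definition ser_xlast S : fseries C := FSeries 1 (cb S).
Definition ser_ulast S : fseries C := FSeries (-1) (ce S).

Definition solves_system S : Prop :=
  forall q : rat,
  [/\ forall j, fs_at Q (fs_deriv Q (ser_x S j)) q
        = - 2 * fs_at Q (fs_mul (ser_x S j) (ser_u S j)) q,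
      forall j, fs_at Q (fs_deriv Q (ser_u S j)) q
        = - fs_at Q (fs_mul (ser_u S j) (ser_ulast S)) q
          + (d j)%:R^-1 * fs_at Q (ser_x S j) q,
      fs_at Q (fs_deriv Q (ser_xlast S)) q
        = fs_at Q (fs_mul (ser_xlast S) (ser_ulast S)) q
    & fs_at Q (fs_deriv Q (ser_ulast S)) q
        = - \sum_k (d k)%:R * fs_at Q (fs_mul (ser_u S k) (ser_u S k)) q].

(* the factor \sum d_k u_k^2 - u_{r+1}^2 + \sum x_k + 1 of H vanishes *)
Definition on_H0 S : Prop :=
  forall q : rat,
    \sum_k (d k)%:R * fs_at Q (fs_mul (ser_u S k) (ser_u S k)) q
    - fs_at Q (fs_mul (ser_ulast S) (ser_ulast S)) q
    + \sum_k fs_at Q (ser_x S k) q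
    + fs_at Q fs_one q = 0.

Variables (a0 : 'I_r -> C) (b0 : C).

Definition c0 j : C :=
  if (j < l)%N then - ratr (alpha j) / 2 else a0 j / (2 * (d j)%:R).

Definition leading S : Prop :=
  [/\ forall j, ca S j 0%N = a0 j, cb S 0%N = b0, forall j, cc S j 0%N = c0 j
    & ce S 0%N = 1].

(* Unknowns are ordered (a_j)_j, b, (c_j)_j, e, and the equations accordingly: *)
(* those of x_1, .., x_r, x_{r+1}, u_1, .., u_r, u_{r+1}.                      *)
Definition Xmat (iota : C) : 'M[C]_(r + 1 + (r + 1)) :=
  block_mx
    (iota%:M)
    (block_mx (diag_mx (\row_j (if (j < l)%N then 2 * a0 j else 0))) 0
              0 (- b0)%:M)
    (block_mx (diag_mx (\row_j (if (j < l)%N then 0 else - (d j)%:R^-1))) 0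
              0 0)
    (block_mx (diag_mx (\row_j (if (j < l)%N then iota else iota + 2)))
              (\col_j c0 j)
              (\row_j (if (j < l)%N then 2 * (d j)%:R * c0 j else 0))
              (iota - 1)%:M).

Definition resonance (iota : C) : Prop := \det (Xmat iota) = 0.

Definition unknowns S (i : nat) : 'cV[C]_(r + 1 + (r + 1)) :=
  col_mx (col_mx (\col_j ca S j i) (cb S i)%:M)
         (col_mx (\col_j cc S j i) (ce S i)%:M).

(* coefficients with a negative index are zero *)
Definition zcoef (f : nat -> C) (k : int) : C :=
  if k is Posz n then f n else 0.

(* N = 2 / Q, and alpha_j = - 2 + s_j Q for j < l *)
Variables (s : 'I_r -> int) (N : nat).

(* The range 0 <= k < i.+1 - m, with truncated subtraction, is 0 <= k <= i - m *)
(* if m <= i and is empty otherwise.                                           *)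
Definition rhs_a S j (i : nat) : C :=
  if (j < l)%N then - 2 * \sum_(1 <= k < i) ca S j (i - k)%N * cc S j k
  else - 2 * \sum_(0 <= k < (i.+1 - N)%N) ca S j (i - N - k)%N * cc S j k.

Definition rhs_b S (i : nat) : C := \sum_(1 <= k < i) cb S (i - k)%N * ce S k.

Definition rhs_c S j (i : nat) : C :=
  - \sum_(1 <= k < i) cc S j (i - k)%N * ce S k
  + (if (j < l)%N then (d j)%:R^-1 * zcoef (ca S j) (i%:Z - s j) else 0).

Definition rhs_e S (i : nat) : C :=
  - \sum_(j < r | (j < l)%N)
      (d j)%:R * \sum_(1 <= k < i) cc S j (i - k)%N * cc S j k
  - \sum_(j < r | ~~ (j < l)%N)
      (d j)%:R * \sum_(0 <= k < (i.+1 - 2 * N)%N)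
                   cc S j (i - 2 * N - k)%N * cc S j k.

Definition rhs S (i : nat) : 'cV[C]_(r + 1 + (r + 1)) :=
  col_mx (col_mx (\col_j rhs_a S j i) (rhs_b S i)%:M)
         (col_mx (\col_j rhs_c S j i) (rhs_e S i)%:M).

Definition solves_step S (i : nat) : Prop :=
  Xmat (ratr (i%:R * Q)) *m unknowns S i = rhs S i.

(* S carries the prescribed leading coefficients and solves the linear systems *)
(* at the steps before the top resonance; its other coefficients are junk.     *)
Definition solves_before S : Prop :=
  leading S /\ forall i, (0 < i < N)%N -> solves_step S i.

(* rhs S N only involves coefficients of S of index less than N *)
Definition compatible S : Prop := exists v, Xmat 2 *m v = rhs S N.

(* lambda |-> p + lambda w parametrizes the solutions at the top resonance *)
Definition top_parametrization S (p w : 'cV[C]_(r + 1 + (r + 1))) : Prop :=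
  w <> 0 /\
  forall v, Xmat 2 *m v = rhs S N <-> exists lambda : C, v = p + lambda *: w.

(* T is a formal solution which continues the coefficients of S of index less  *)
(* than N with the solution v at the top resonance.                            *)
Definition continuation S (v : 'cV[C]_(r + 1 + (r + 1))) T : Prop :=
  [/\ forall i, (i < N)%N -> unknowns T i = unknowns S i,
      unknowns T N = v & solves_system T].

End Expansions.

Definition top_resonance (C : numFieldType) (r l : nat) (d : 'I_r -> nat)
    (alpha : 'I_r -> rat) (a0 : 'I_r -> C) (b0 iota : C) : Prop :=
  resonance l d alpha a0 b0 iota /\
  forall iota', resonance l d alpha a0 b0 iota' -> iota' <= iota.

(* Main.v *)
(** The function [F = \sum d_k u_k^2 - u_{r+1}^2 + \sum x_k] is a first integral
    of the system. Along a formal expansion, [F = \sum_i F_i t^(-2 + iQ)], and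
    [(iQ - 2) F_i] is a combination of the residuals of the equations up to step
    [i]. At [iQ = 2] the left-hand side vanishes, and what remains on the right
    is exactly the pairing of the right-hand side of the linear system with the
    cokernel of [X(2)]: this gives the compatibility condition. For a formal
    solution, all [F_i] with [iQ <> 2] vanish, and the coefficient at [iQ = 2] is
    an affine function of slope [-3] of the free parameter, so that the parameter
    can be chosen with [F = -1], i.e. [H = 0]. At all other
    steps the linear systems are uniquely solvable, hence the formal solution
    exists. *)

Require Import Defs.
From mathcomp Require Import all_boot all_order all_algebra.
From mathcomp Require Import reals complex.
From mathcomp Require Import ring lra zify.
Import Order.TTheory GRing.Theory Num.Theory.
Local Open Scope ring_scope.

Set Implicit Arguments.
Unset Strict Implicit.
Unset Printing Implicit Defensive.

(** * Cauchy products and shifts of coefficient sequences *)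

Section Convolution.
Variable K : comNzRingType.
Implicit Types f g : nat -> K.

(** Multiplication by [t^(nQ)]; it places series with different starting exponents on one common
    grid. *)
Definition shift (n : nat) f : nat -> K :=
  fun i => if (i < n)%N then 0 else f (i - n)%N.

Definition conv f g : nat -> K :=
  fun i => \sum_(0 <= k < i.+1) f (i - k)%N * g k.

Lemma shift0 f i : shift 0 f i = f i.
Proof. by rewrite /shift ltn0 subn0. Qed.

Lemma shift_lt n f i : (i < n)%N -> shift n f i = 0.
Proof. by rewrite /shift => ->. Qed.

Lemma shiftDr n f i : shift n f (i + n)%N = f i.
Proof. by rewrite /shift ltnNge leq_addl addnK. Qed.

Lemma shiftD m n f i : shift (m + n) f (i + n)%N = shift m f i.
Proof. by rewrite /shift ltn_add2r subnDr. Qed.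

Lemma convC f g : conv f g =1 conv g f.
Proof.
move=> i; rewrite /conv big_nat_rev /= !big_nat.
apply: eq_bigr => k /andP[_ le_ki].
by rewrite add0n subSS subKn // mulrC.
Qed.

Lemma conv_shiftr n f g : conv f (shift n g) =1 shift n (conv f g).
Proof.
move=> i; rewrite {2}/shift; have [lt_in | le_ni] := ltnP i n.
  rewrite /conv big_nat big1 // => k /andP[_ le_ki].
  by rewrite shift_lt ?mulr0 // (leq_ltn_trans _ lt_in).
rewrite /conv (big_cat_nat (n := n)) //=; last exact: leqW.
rewrite big_nat big1 ?add0r; last first.
  by move=> k /andP[_ lt_kn]; rewrite shift_lt ?mulr0.
rewrite -{1}[n]add0n big_addn subSn //.
by apply: eq_bigr => k _; rewrite shiftDr [(k + n)%N]addnC subnDA.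
Qed.

Lemma conv_ext f f' g g' i : (forall k, (k <= i)%N -> f k = f' k) ->
  (forall k, (k <= i)%N -> g k = g' k) -> conv f g i = conv f' g' i.
Proof.
move=> eq_f eq_g; rewrite /conv !big_nat; apply: eq_bigr => k /andP[_ le_ki].
by rewrite eq_f ?leq_subr // eq_g.
Qed.

Lemma conv_shift m n f g :
  conv (shift m f) (shift n g) =1 shift (m + n) (conv f g).
Proof.
move=> i; rewrite conv_shiftr addnC; have [lt_in | le_ni] := ltnP i n.
  by rewrite !shift_lt // ltn_addr.
by rewrite -(subnK le_ni) shiftDr [(n + m)%N]addnC shiftD convC conv_shiftr;
   rewrite /shift convC.
Qed.

Lemma conv0 f g : conv f g 0 = f 0%N * g 0%N.
Proof. by rewrite /conv big_nat1. Qed.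

Lemma conv_ends f g i : (0 < i)%N ->
  conv f g i = f i * g 0%N + f 0%N * g i
    + \sum_(1 <= k < i) f (i - k)%N * g k.
Proof.
move=> i_gt0; rewrite /conv big_nat_recl // big_add1.
by case: i i_gt0 => // i _; rewrite big_nat_recr //= subn0 subnn; ring.
Qed.

Lemma conv_vanish f g i : (forall k, (k < i)%N -> g k = 0) ->
  conv f g i = f 0%N * g i.
Proof.
move=> g0; rewrite /conv big_nat_recr //= subnn big_nat big1 ?add0r //.
by move=> k /andP[_ lt_ki]; rewrite g0 ?mulr0.
Qed.

(** Truncation does not affect low coefficients, so identities between power series can be proved in
    the polynomial ring. *)
Lemma coef_mul_poly n f g i : (i < n)%N ->
  ((\poly_(k < n) f k) * (\poly_(k < n) g k))`_i = conv f g i.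
Proof.
move=> lt_in; rewrite coefMr /conv big_mkord; apply: eq_bigr => k _.
by rewrite !coef_poly !(leq_ltn_trans _ lt_in) ?leq_subr // -ltnS.
Qed.

End Convolution.

(** * The first integral as an identity between residuals *)

Section FirstIntegral.
Variables (K : numFieldType) (r : nat) (d : 'I_r -> nat) (q : K).
Hypothesis d_neq0 : forall j, (d j)%:R != 0 :> K.

(** With [X] standing for [t^Q] and [q] for [Q], this is the derivation [t d/dt]. *)
Definition euler (p : {poly K}) : {poly K} := q *: ('X * p^`()).

Lemma coef_euler p i : (euler p)`_i = i%:R * q * p`_i.
Proof.
rewrite /euler coefZ coefXM coef_deriv; case: i => [|i] /=; first by ring.
by rewrite -[_ *+ i.+1]mulr_natl; ring.
Qed.

Lemma eulerD p1 p2 : euler (p1 + p2) = euler p1 + euler p2.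
Proof. by rewrite /euler derivD mulrDr scalerDr. Qed.

Lemma euler_sum (F : 'I_r -> {poly K}) :
  euler (\sum_k F k) = \sum_k euler (F k).
Proof.
rewrite (big_morph euler eulerD (id1 := 0)) //.
by rewrite /euler deriv0 mulr0 scaler0.
Qed.

Lemma eulerM p1 p2 : euler (p1 * p2) = euler p1 * p2 + p1 * euler p2.
Proof. by rewrite /euler derivM -!mul_polyC; ring. Qed.

Lemma euler_natM n p : euler (n%:R * p) = n%:R * euler p.
Proof. by rewrite eulerM {1}/euler -polyC_natr derivC mulr0 scaler0 mul0r add0r. Qed.

Lemma eulerN p : euler (- p) = - euler p.
Proof. by rewrite /euler derivN mulrN scalerN. Qed.

(** Read [x_k = t^-2 A_k], [u_k = t^-1 C_k], [u_{r+1} = t^-1 E]: the left-hand side is [t^3 dF/dt].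
    Substituting the equations up to their residuals, all cubic and mixed terms cancel, for
    arbitrary [A], [C], [E]. *)
Lemma first_integral_poly (A C : 'I_r -> {poly K}) (E : {poly K}) :
  let F := \sum_k (d k)%:R * (C k * C k) - E * E + \sum_k A k in
  euler F - 2 * F =
    \sum_k (2 * (d k)%:R * (C k * (euler (C k) - C k + C k * E
                                  - ((d k)%:R^-1)%:P * A k))
            + (euler (A k) - 2 * A k + 2 * (A k * C k)))
    - 2 * (E * (euler E - E + \sum_k (d k)%:R * (C k * C k))).
Proof.
move=> F; rewrite /F !eulerD eulerN eulerM !euler_sum.
set SC := \sum_k (d k)%:R * _; set SA := \sum_k A k.
have -> : \sum_k euler ((d k)%:R * (C k * C k)) =
    \sum_k 2 * (d k)%:R * (C k * euler (C k)).
  by apply: eq_bigr => k _; rewrite euler_natM eulerM; ring.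
(* The products [C k * A k] of the [u] and [x] equations cancel here; the remaining multiples of [E]
   cancel against the last equation after summation. *)
have term k : 2 * (d k)%:R * (C k * (euler (C k) - C k + C k * E
                                  - ((d k)%:R^-1)%:P * A k))
            + (euler (A k) - 2 * A k + 2 * (A k * C k)) =
   (2 * (d k)%:R * (C k * euler (C k)) + euler (A k))
   + ((2 * E - 2) * ((d k)%:R * (C k * C k)) + (- 2) * A k).
  have dV : (d k)%:R * ((d k)%:R^-1)%:P = 1 :> {poly K}.
    by rewrite -polyC_natr -polyCM divff.
  transitivity (2 * (d k)%:R * (C k * (euler (C k) - C k + C k * E))
     - 2 * ((d k)%:R * ((d k)%:R^-1)%:P) * C k * A k
     + (euler (A k) - 2 * A k + 2 * (A k * C k))); first by ring.
  by rewrite dV; ring.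
rewrite (eq_bigr _ (fun k _ => term k)) !big_split /= -!mulr_sumr -/SC -/SA.
by ring.
Qed.

Variables (A C : 'I_r -> nat -> K) (E : nat -> K).

(** This and the next two are the defects of the equations at [t^(-3+iQ)] for [x_k] and at
    [t^(-2+iQ)] for [u_k] and [u_{r+1}], when [x_k] is based at exponent -2 and the [u] at -1. In
    the same normalization [energy i] is [F_i]. *)
Definition res_x k i := (i%:R * q - 2) * A k i + 2 * conv (A k) (C k) i.
Definition res_u k i :=
  (i%:R * q - 1) * C k i + conv (C k) E i - (d k)%:R^-1 * A k i.
Definition res_ulast i :=
  (i%:R * q - 1) * E i + \sum_k (d k)%:R * conv (C k) (C k) i.

Definition energy i :=
  \sum_k (d k)%:R * conv (C k) (C k) i - conv E E i + \sum_k A k i.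

Lemma first_integral i :
  (i%:R * q - 2) * energy i =
  \sum_k (2 * (d k)%:R * conv (C k) (res_u k) i + res_x k i)
  - 2 * conv E res_ulast i.
Proof.
pose P (f : nat -> K) := \poly_(k < i.+1) f k.
have PE f k : (k <= i)%N -> (P f)`_k = f k by move=> ?; rewrite coef_poly ltnS ifT.
have PM f g k : (k <= i)%N -> (P f * P g)`_k = conv f g k.
  by move=> ?; rewrite coef_mul_poly.
have natM n (p : {poly K}) k : (n%:R * p)`_k = n%:R * p`_k.
  by rewrite -polyC_natr coefCM.
(* The residual polynomials agree with the residual sequences only up to degree [i], which suffices
   for coefficient [i] of a product. *)
have PMr f (p : {poly K}) (g : nat -> K) : (forall k, (k <= i)%N -> p`_k = g k) ->
    (P f * p)`_i = conv f g i.
  move=> pg; rewrite coefMr /conv big_mkord; apply: eq_bigr => k _.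
  by rewrite PE ?leq_subr // pg // -ltnS.
have coefF : (\sum_k (d k)%:R * (P (C k) * P (C k)) - P E * P E
    + \sum_k P (A k))`_i = energy i.
  rewrite coefD coefB !coef_sum PM //; congr (_ - _ + _).
    by apply: eq_bigr => k _; rewrite natM PM.
  by apply: eq_bigr => k _; rewrite PE.
have /(congr1 (fun p : {poly K} => p`_i)) :=
  first_integral_poly (fun k => P (A k)) (fun k => P (C k)) (P E).
rewrite coefB coef_euler natM coefF -mulrBl => ->.
rewrite coefB coef_sum; congr (_ - _).
  apply: eq_bigr => k _; rewrite coefD -natrM natM natrM; congr (_ + _).
    congr (_ * _); apply: PMr => m le_mi.
    by rewrite coefB !coefD coefN coef_euler coefCM PM // !PE // /res_u; ring.
  by rewrite coefD coefB coef_euler !natM PM // PE // /res_x; ring.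
rewrite natM; congr (_ * _); apply: PMr => m le_mi.
rewrite coefD coefB coef_euler PE // coef_sum /res_ulast.
congr (_ + _); first by ring.
by apply: eq_bigr => k _; rewrite natM PM.
Qed.

End FirstIntegral.

(** * Coefficients of a formal series on and off a grid *)

Section FormalSeriesCoefficients.
Variables (K : fieldType) (Q : rat).
Hypothesis Q_neq0 : Q != 0.
Implicit Type f : fseries K.

Lemma fs_at_on f e n i : fs_exp f = e + n%:R * Q ->
  fs_at Q f (e + i%:R * Q) = shift n (fs_coef f) i.
Proof.
move=> def_e; rewrite /fs_at def_e.
have -> : (e + i%:R * Q - (e + n%:R * Q)) / Q = i%:R - n%:R by field.
rewrite /shift; have [lt_in | le_ni] := ltnP i n.
  case: ifP => // /natr_ge0; rewrite subr_ge0 ler_nat.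
  by rewrite leqNgt lt_in.
by rewrite -natrB // natr_nat natrK.
Qed.

Lemma fs_at_off f e n q : fs_exp f = e + n%:R * Q ->
  (forall i : nat, q != e + i%:R * Q) -> fs_at Q f q = 0.
Proof.
move=> def_e q_off; rewrite /fs_at; case: ifP => // /natrP[m def_m].
case/eqP: (q_off (m + n)%N).
by rewrite -[q](subrK (fs_exp f)) -[_ - _](divfK Q_neq0) def_m def_e natrD; ring.
Qed.

End FormalSeriesCoefficients.

(** Course-of-values recursion: the hypothesis says that [step i] reads only the values below [i].
    It produces coefficient sequences from the linear systems. *)
Lemma strong_recursion (X : Type) (x0 : X) (step : nat -> (nat -> X) -> X) :
  (forall i v v', (forall k, (k < i)%N -> v k = v' k) ->
     step i v = step i v') ->
  exists v : nat -> X, forall i, v i = step i v.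
Proof.
move=> step_ext.
(* [build n] carries the final values below [n] and the default [x0] from [n] on. *)
pose build := fix build n : nat -> X :=
  if n is n'.+1 then
    fun k => if k == n' then step n' (build n') else build n' k
  else fun=> x0.
have build_stable n k : (k < n)%N -> build n k = build k.+1 k.
  elim: n => // n IHn; rewrite ltnS leq_eqVlt => /predU1P[-> // | lt_kn] /=.
  by rewrite ltn_eqF // IHn //= eqxx.
exists (fun k => build k.+1 k) => i /=; rewrite eqxx.
by apply: step_ext => k lt_ki; rewrite build_stable //= eqxx.
Qed.

(** * The matrix X: kernel, image and resonances *)

Section LinearSystem.
Variables (K : numFieldType) (r l : nat) (d : 'I_r -> nat).
Variables (alpha : 'I_r -> rat) (a0 : 'I_r -> K) (b0 : K).
Hypothesis hd : forall j, (2 <= d j)%N.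
Hypothesis hell : \sum_(j < r | (j < l)%N) (d j)%:R * alpha j ^+ 2 = 4.

Notation c0 := (c0 l d alpha a0).
Notation X := (Xmat l d alpha a0 b0).

(** The block layout shared by [unknowns] and [rhs], both of which are convertible to a [stack]. *)
Definition stack (a : 'I_r -> K) (b : K) (c : 'I_r -> K) (e : K) :
    'cV[K]_(r + 1 + (r + 1)) :=
  col_mx (col_mx (\col_j a j) b%:M) (col_mx (\col_j c j) e%:M).

(** Lets the recursion run over column vectors, from which the coefficients are then read off. *)
Definition unstack (v : nat -> 'cV[K]_(r + 1 + (r + 1))) : coefs K r :=
  Coefs (fun j i => usubmx (usubmx (v i)) j 0) (fun i => dsubmx (usubmx (v i)) 0 0)
        (fun j i => usubmx (dsubmx (v i)) j 0) (fun i => dsubmx (dsubmx (v i)) 0 0).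

Lemma unknowns_unstack v i : unknowns (unstack v) i = v i.
Proof.
have colE m (u : 'cV[K]_m) : \col_j u j 0 = u.
  by apply/colP => j; rewrite mxE.
by rewrite /unknowns /unstack /= !colE -!mx11_scalar !vsubmxK.
Qed.

Lemma stackP v : exists a b c e, v = stack a b c e.
Proof.
by rewrite -(unknowns_unstack (fun=> v) 0); do 4!eexists; reflexivity.
Qed.

Lemma stack_inj a b c e a' b' c' e' :
  stack a b c e = stack a' b' c' e' <->
  [/\ a =1 a', b = b', c =1 c' & e = e'].
Proof.
split=> [|[eqa -> eqc ->]]; last first.
  by congr (col_mx (col_mx _ _) (col_mx _ _)); apply/colP => j;
     rewrite !mxE ?eqa ?eqc.
case/eq_col_mx => /eq_col_mx[/colP eqa /rowP/(_ 0) eqb].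
case/eq_col_mx => /colP eqc /rowP/(_ 0) eqe; split.
- by move=> j; have := eqa j; rewrite !mxE.
- by move: eqb; rewrite !mxE.
- by move=> j; have := eqc j; rewrite !mxE.
- by move: eqe; rewrite !mxE.
Qed.

Lemma stack_combine a b c e lambda a' b' c' e' :
  stack a b c e + lambda *: stack a' b' c' e' =
  stack (fun j => a j + lambda * a' j) (b + lambda * b')
        (fun j => c j + lambda * c' j) (e + lambda * e').
Proof.
rewrite /stack !scale_col_mx !add_col_mx.
by congr (col_mx (col_mx _ _) (col_mx _ _)); apply/colP => j;
   rewrite !mxE // ord1 !mulr1n.
Qed.

Lemma stack0 : stack (fun=> 0) 0 (fun=> 0) 0 = 0.
Proof.
rewrite /stack !raddf0; have -> : \col_(j < r) (0 : K) = 0.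
  by apply/colP => j; rewrite !mxE.
by rewrite !col_mx0.
Qed.

Lemma Xmat_stack iota a b c e :
  X iota *m stack a b c e =
  stack (fun j => iota * a j + (if (j < l)%N then 2 * a0 j * c j else 0))
        (iota * b - b0 * e)
        (fun j => (if (j < l)%N then iota * c j
                   else - (d j)%:R^-1 * a j + (iota + 2) * c j) + c0 j * e)
        (2 * (\sum_(j < r | (j < l)%N) (d j)%:R * c0 j * c j)
         + (iota - 1) * e).
Proof.
rewrite /Xmat /stack !mul_block_col !mul_scalar_mx !mul0mx !mul_diag_mx.
rewrite !(addr0, add0r) !scale_col_mx !add_col_mx.
congr (col_mx (col_mx _ _) (col_mx _ _)); apply/colP => j; rewrite !mxE ?big_ord1 ?mxE.
- by case: ifP; rewrite ?mul0r.
- by rewrite ord1 !mulr1n mulNr.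
- by rewrite mulr1n; case: ifP => _; ring.
rewrite ord1 !mulr1n add0r; congr (_ + _).
rewrite mulr_sumr [RHS]big_mkcond; apply: eq_bigr => k _; rewrite !mxE.
by case: ifP => _; ring.
Qed.

(** The ellipsoid equation divided by 4, as [c0 j = - alpha j / 2] for [j < l]. *)
Lemma sum_c0_sq : \sum_(j < r | (j < l)%N) (d j)%:R * c0 j * c0 j = 1.
Proof.
have := congr1 (fun x : rat => ratr x : K) hell.
rewrite rmorph_sum ratr_nat => Eell.
transitivity (4^-1 * \sum_(j < r | (j < l)%N) ratr ((d j)%:R * alpha j ^+ 2) : K).
  rewrite mulr_sumr; apply: eq_bigr => j lt_jl; rewrite /Defs.c0 lt_jl.
  by rewrite rmorphM rmorphXn /= ratr_nat; field.
rewrite Eell mulVf ?pnatr_eq0 //.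
Qed.

(** For [j < l] the [u_j] rows give [c j = - c0 j * e / iota]. By [sum_c0_sq] the last row then
    becomes [(iota - 2)(iota + 1) e = 0], so [e = 0], and the other unknowns follow; the value -2 is
    excluded for the [c j] with [j >= l]. *)
Lemma Xmat_kernel (iota : K) (v : 'cV_(r + 1 + (r + 1))) :
  iota != 0 -> iota != -1 -> iota != -2 -> iota != 2 -> X iota *m v = 0 -> v = 0.
Proof.
move=> iota0 iotaN1 iotaN2 iota2; have [a [b [c [e ->]]]] := stackP v.
rewrite Xmat_stack -stack0 => /stack_inj[Ea Eb Ec Ee].
have Ecl (j : 'I_r) : (j < l)%N -> c j = - (c0 j * e / iota).
  move=> lt_jl; move: (Ec j); rewrite lt_jl => /eqP; rewrite addr_eq0 => /eqP E.
  by rewrite -mulNr -E mulrC mulKf.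
have e0 : e = 0.
  move: Ee; under eq_bigr => j lt_jl do rewrite (Ecl j lt_jl).
  have -> : \sum_(j < r | (j < l)%N) (d j)%:R * c0 j * (- (c0 j * e / iota))
    = - (e / iota).
    transitivity (- (e / iota) * \sum_(j < r | (j < l)%N) (d j)%:R * c0 j * c0 j).
      by rewrite mulr_sumr; apply: eq_bigr => j _; ring.
    by rewrite sum_c0_sq mulr1.
  move=> Ee; have : (iota - 2) * (iota + 1) * e = 0.
    transitivity (iota * (2 * - (e / iota) + (iota - 1) * e)).
      by field.
    by rewrite Ee mulr0.
  move/eqP; rewrite !mulf_eq0 subr_eq0 addr_eq0 (negPf iota2) (negPf iotaN1).
  by move=> /= /eqP.
have a0' j : a j = 0.
  apply: (mulfI iota0); rewrite mulr0 -[RHS](Ea j).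
  case: ifP => [lt_jl | _]; last by rewrite addr0.
  by rewrite Ecl // e0 mulr0 mul0r oppr0 mulr0 addr0.
apply/stack_inj; split=> // [|j].
  by apply: (mulfI iota0); rewrite mulr0 -[RHS]Eb e0 mulr0 subr0.
case: (boolP (j < l)%N) => [lt_jl | ge_jl].
  by rewrite Ecl // e0 mulr0 mul0r oppr0.
move: (Ec j); rewrite (negPf ge_jl) a0' e0 !mulr0 addr0 add0r => /eqP.
by rewrite mulf_eq0 addr_eq0 (negPf iotaN2) => /eqP.
Qed.

Lemma Xmat_unit (iota : K) : iota != 0 -> iota != -1 -> iota != -2 ->
  iota != 2 -> X iota \in unitmx.
Proof.
(* [det0P] yields a left null vector, hence the passage to the transpose. *)
move=> iota0 iotaN1 iotaN2 iota2; rewrite unitmxE unitfE -det_tr.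
apply/negP => /det0P[v v_neq0 Xv]; case/eqP: v_neq0; apply: trmx_inj.
rewrite trmx0; apply: (Xmat_kernel iota0 iotaN1 iotaN2 iota2).
by rewrite -[X iota]trmxK -trmx_mul Xv trmx0.
Qed.

(** The null vector of [X 2] with last component [e = 1]: the [u_j] rows give [c], the [x_j] rows
    then give [a]. *)
Definition top_kernel : 'cV[K]_(r + 1 + (r + 1)) :=
  stack (fun j => if (j < l)%N then a0 j * c0 j / 2 else 0) (b0 / 2)
        (fun j => if (j < l)%N then - (c0 j / 2) else - (c0 j / 4)) 1.

Lemma top_kernel_neq0 : top_kernel != 0.
Proof.
apply/eqP; rewrite -stack0 => /stack_inj[_ _ _ /eqP].
by rewrite oner_eq0.
Qed.

Lemma Xmat2_top_kernel : X 2 *m top_kernel = 0.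
Proof.
rewrite Xmat_stack -stack0; apply/stack_inj; split=> [j||j|] /=.
- by case: ifP => _; field.
- by field.
- by case: (j < l)%N; field; rewrite ?pnatr_eq0 ?gtn_eqF ?(leq_trans _ (hd j)).
transitivity (1 - \sum_(j < r | (j < l)%N) (d j)%:R * c0 j * c0 j).
  have -> : \sum_(j < r | (j < l)%N) (d j)%:R * c0 j *
      (if (j < l)%N then - (c0 j / 2) else - (c0 j / 4)) =
    - 2^-1 * \sum_(j < r | (j < l)%N) (d j)%:R * c0 j * c0 j.
    by rewrite mulr_sumr; apply: eq_bigr => j ->; ring.
  by field.
by rewrite sum_c0_sq subrr.
Qed.

(** All rows but the last determine [a], [b], [c] from [e], so the kernel is a line and [lambda] is
    the component [e]. *)
Lemma Xmat2_kernel (v : 'cV_(r + 1 + (r + 1))) :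
  X 2 *m v = 0 -> exists lambda, v = lambda *: top_kernel.
Proof.
have [a [b [c [e ->]]]] := stackP v.
rewrite Xmat_stack -stack0 => /stack_inj[Ea Eb Ec _].
have two0 : 2 != 0 :> K by rewrite pnatr_eq0.
have four0 : 4 != 0 :> K by rewrite pnatr_eq0.
exists e; rewrite -[RHS]add0r -stack0 stack_combine; apply/stack_inj.
have Ea' j : a j = e * (if (j < l)%N then a0 j * c0 j / 2 else 0).
  apply: (mulfI two0); move: (Ea j) (Ec j); case: ifP => _.
    move=> Eaj Ecj.
    transitivity (a0 j * (c0 j * e)); last by field.
    apply/eqP; rewrite -subr_eq0; apply/eqP.
    (* Subtracting [a0 j] times the [u_j] row from the [x_j] row eliminates [c j]. *)
    transitivity ((2 * a j + 2 * a0 j * c j) - a0 j * (2 * c j + c0 j * e)).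
      by ring.
    by rewrite Eaj Ecj mulr0 subrr.
  by rewrite addr0 => -> _; rewrite !mulr0.
split=> [j||j|]; rewrite ?add0r ?mulr1 //.
  by apply: (mulfI two0); move/eqP: Eb; rewrite subr_eq0 => /eqP ->; field.
move: (Ec j) (Ea' j); case: ifP => _ /eqP; rewrite addr_eq0 => /eqP Ecj Eaj.
  by apply: (mulfI two0); rewrite Ecj; field.
apply: (mulfI four0); move: Ecj; rewrite Eaj !mulr0 add0r -natrD => ->.
by field.
Qed.

(** At [iota = 2] the last row is the combination of the [u_j] rows, [j < l], with weights
    [d j * c0 j]. Under the matching condition on the right-hand side it is therefore redundant, and
    the remaining rows are solved with [e = 0]. *)
Lemma Xmat2_solvable ra rb rc re :
  \sum_(j < r | (j < l)%N) (d j)%:R * c0 j * rc j = re ->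
  exists v, X 2 *m v = stack ra rb rc re.
Proof.
move=> compat.
pose c (j : 'I_r) := if (j < l)%N then rc j / 2
  else (rc j + (d j)%:R^-1 * (ra j / 2)) / 4.
exists (stack (fun j => if (j < l)%N then ra j / 2 - a0 j * c j else ra j / 2)
              (rb / 2) c 0).
rewrite Xmat_stack; apply/stack_inj; split=> [j||j|] /=.
- by case: ifP => _; field.
- by field.
- rewrite /c; case: (j < l)%N; field;
  by rewrite ?pnatr_eq0 ?gtn_eqF ?(leq_trans _ (hd j)).
rewrite mulr0 addr0 -compat mulr_sumr; apply: eq_bigr => j lt_jl.
by rewrite /c lt_jl; field.
Qed.

(** The only candidates are 0, -1, -2 and 2. They are compared with 2 one by one, since the order of
    [K] may be partial, as it is for complex numbers. *)
Lemma top_resonance2 : top_resonance l d alpha a0 b0 2.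
Proof.
split=> [|iota].
  apply/eqP; rewrite -det_tr; apply/det0P; exists top_kernel^T.
    by rewrite -(inj_eq trmx_inj) trmxK trmx0 top_kernel_neq0.
  by rewrite -trmx_mul Xmat2_top_kernel trmx0.
rewrite /resonance => det0.
have [-> | iota0] := eqVneq iota 0; first exact: ler0n.
have [-> | iotaN1] := eqVneq iota (-1).
  by apply: le_trans (ler0n _ _); rewrite oppr_le0 ler01.
have [-> | iotaN2] := eqVneq iota (-2).
  by apply: le_trans (ler0n _ _); rewrite oppr_le0 ler0n.
have [-> // | iota2] := eqVneq iota 2.
have := Xmat_unit iota0 iotaN1 iotaN2 iota2.
by rewrite unitmxE det0 unitr0.
Qed.

End LinearSystem.

(** * Reduction of series identities to a grid of exponents *)

Section Grid.
Variables (K : numFieldType) (Q : rat).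
Hypothesis Q_neq0 : Q != 0.
Implicit Types f g : fseries K.

(** Turns a statement over all rational exponents into one over natural indices, once it is known
    off the grid. *)
Lemma on_grid (e : rat) (P : rat -> Prop) :
  (forall x, (forall i : nat, x != e + i%:R * Q) -> P x) ->
  (forall x, P x) <-> (forall i : nat, P (e + i%:R * Q)).
Proof.
move=> P_off; split=> [PA i | P_on x]; first exact: PA.
have [/natrP[i def_i] | off] := boolP ((x - e) / Q \is a Num.nat).
  have -> : x = e + i%:R * Q by rewrite -def_i divfK // addrC subrK.
  exact: P_on.
apply: P_off => i; apply: contra off => /eqP ->.
by rewrite addrC addKr mulfK // natr_nat.
Qed.

Lemma fs_at_deriv f e n i x : fs_exp f = e + n%:R * Q ->
  x = e - 1 + i%:R * Q ->
  fs_at Q (fs_deriv Q f) x = ratr (e + i%:R * Q) * shift n (fs_coef f) i.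
Proof.
move=> def_f ->; rewrite (@fs_at_on _ _ Q_neq0 _ _ n) /=; last by rewrite def_f; ring.
rewrite /shift; have [_ | le_ni] := ltnP i n; first by rewrite mulr0.
by rewrite def_f natrB //; congr (ratr _ * _); ring.
Qed.

Lemma fs_at_mul f g e e' n n' i x : fs_exp f = e + n%:R * Q ->
  fs_exp g = e' + n'%:R * Q -> x = e + e' + i%:R * Q ->
  fs_at Q (fs_mul f g) x
  = conv (shift n (fs_coef f)) (shift n' (fs_coef g)) i.
Proof.
move=> def_f def_g ->; rewrite conv_shift (@fs_at_on _ _ Q_neq0 _ _ (n + n')) //=.
by rewrite def_f def_g natrD; ring.
Qed.

Lemma fs_at_ser f e n i x : fs_exp f = e + n%:R * Q ->
  x = e + i%:R * Q -> fs_at Q f x = shift n (fs_coef f) i.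
Proof. by move=> def_f ->; apply: fs_at_on. Qed.

Lemma fs_off_deriv f e e1 n x : fs_exp f = e + n%:R * Q -> e1 = e - 1 ->
  (forall i : nat, x != e1 + i%:R * Q) -> fs_at Q (fs_deriv Q f) x = 0.
Proof.
move=> def_f -> off; apply: (fs_at_off Q_neq0 (n := n)) off.
by rewrite /= def_f; ring.
Qed.

Lemma fs_off_mul f g e e' e1 n n' x : fs_exp f = e + n%:R * Q ->
  fs_exp g = e' + n'%:R * Q -> e1 = e + e' ->
  (forall i : nat, x != e1 + i%:R * Q) -> fs_at Q (fs_mul f g) x = 0.
Proof.
move=> def_f def_g -> off; apply: (fs_at_off Q_neq0 (n := n + n')) off.
by rewrite /= def_f def_g natrD; ring.
Qed.

End Grid.

(** * The expansions on common grids *)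

Section Expansion.
Variables (K : numFieldType) (r l : nat) (d : 'I_r -> nat).
Variables (alpha : 'I_r -> rat) (Q : rat) (s : 'I_r -> int) (N : nat).
Variables (a0 : 'I_r -> K) (b0 : K).
Hypothesis hd : forall j, (2 <= d j)%N.
Hypothesis hell : \sum_(j < r | (j < l)%N) (d j)%:R * alpha j ^+ 2 = 4.
Hypothesis hs : forall j : 'I_r, (j < l)%N -> alpha j = - 2 + (s j)%:~R * Q.
Hypothesis hN : N%:R * Q = 2.
Implicit Type S : coefs K r.

Notation c0 := (c0 l d alpha a0).
Notation q := (ratr Q : K).

Lemma N_gt0 : (0 < N)%N.
Proof. by case: N hN => // /eqP; rewrite mul0r eq_sym pnatr_eq0. Qed.

Lemma Q_gt0 : 0 < Q.
Proof.
have : 0 < N%:R * Q by rewrite hN.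
by rewrite pmulr_rgt0 // ltr0n N_gt0.
Qed.

Lemma Q_neq0 : Q != 0. Proof. by rewrite gt_eqF // Q_gt0. Qed.

Lemma d_neq0 j : (d j)%:R != 0 :> K.
Proof. by rewrite pnatr_eq0 -lt0n (leq_trans _ (hd j)). Qed.

(* [d_j >= 2] forces [alpha_j ^ 2 <= 2], hence [alpha_j > -2]. *)
Lemma s_gt0 (j : 'I_r) : (j < l)%N -> 0 < s j.
Proof.
move=> lt_jl.
have le4 : (d j)%:R * alpha j ^+ 2 <= 4.
  rewrite -hell (bigD1 j) //= lerDl sumr_ge0 // => k _.
  by rewrite mulr_ge0 ?ler0n ?sqr_ge0.
have : 2 * alpha j ^+ 2 <= (d j)%:R * alpha j ^+ 2.
  by rewrite ler_wpM2r ?sqr_ge0 // ler_nat hd.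
move=> le2; have : 0 < (s j)%:~R * Q.
  have -> : (s j)%:~R * Q = alpha j + 2 by rewrite hs //; ring.
  by nra.
by rewrite pmulr_lgt0 ?Q_gt0 // ltr0z.
Qed.

Lemma Nq : N%:R * q = 2.
Proof. by rewrite -(ratr_nat K 2) -hN rmorphM /= ratr_nat. Qed.

(* All series are rewritten on the grids [-2 + iQ] (for [x_j]), [-1 + iQ]      *)
(* (for [u_j] and [u_{r+1}]) and [1 + iQ] (for [x_{r+1}]).                      *)
Definition shift_x (j : 'I_r) : nat := if (j < l)%N then `|s j|%N else N.
Definition shift_u (j : 'I_r) : nat := if (j < l)%N then 0%N else N.

Lemma shift_x_gt0 j : (0 < shift_x j)%N.
Proof.
rewrite /shift_x; case: ifP => [lt_jl|_]; last exact: N_gt0.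
by rewrite absz_gt0 gt_eqF // s_gt0.
Qed.

Lemma shift_xE (j : 'I_r) : (j < l)%N -> s j = Posz (shift_x j).
Proof. by move=> lt_jl; rewrite /shift_x lt_jl gez0_abs // ltW // s_gt0. Qed.

Lemma alpha_shift (j : 'I_r) : (j < l)%N -> alpha j = -2 + (shift_x j)%:R * Q.
Proof. by move=> lt_jl; rewrite hs // (shift_xE lt_jl). Qed.

Definition xs S j := shift (shift_x j) (ca S j).
Definition us S j := shift (shift_u j) (cc S j).

Notation rx S := (res_x q (xs S) (us S)).
Notation ru S := (res_u d q (xs S) (us S) (ce S)).
Notation rul S := (res_ulast d q (us S) (ce S)).
(** Kept apart from the other residuals because the first integral does not involve [x_{r+1}]. *)
Definition res_xlast S i := (i%:R * q + 1) * cb S i - conv (cb S) (ce S) i.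
Notation rxl := res_xlast.
Notation en S := (energy d (xs S) (us S) (ce S)).

Lemma exp_x S j : fs_exp (ser_x l alpha S j) = -2 + (shift_x j)%:R * Q.
Proof.
rewrite /=; case: ifP => lt_jl; first exact: alpha_shift.
by rewrite /shift_x lt_jl hN; ring.
Qed.

Lemma exp_u S j : fs_exp (ser_u l S j) = -1 + (shift_u j)%:R * Q.
Proof. by rewrite /= /shift_u; case: ifP => _; rewrite ?hN; ring. Qed.

Lemma exp_xlast S : fs_exp (ser_xlast S) = 1 + 0%:R * Q.
Proof. by rewrite /=; ring. Qed.

Lemma exp_ulast S : fs_exp (ser_ulast S) = -1 + 0%:R * Q.
Proof. by rewrite /=; ring. Qed.

Lemma conv_shift0l (f g : nat -> K) : conv (shift 0 f) g =1 conv f g.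
Proof. by move=> i; apply: conv_ext => k _ //; rewrite shift0. Qed.

Lemma conv_shift0r (f g : nat -> K) : conv f (shift 0 g) =1 conv f g.
Proof. by move=> i; apply: conv_ext => k _ //; rewrite shift0. Qed.

Lemma ratr_exp (z : int) (i : nat) :
  ratr (z%:~R + i%:R * Q) = z%:~R + i%:R * q :> K.
Proof. by rewrite rmorphD rmorphM /= ratr_int ratr_nat. Qed.

(** Each equation lives on one grid, based at -3 for [x_j], -2 for [u_j] and [u_{r+1}], and 0 for
    [x_{r+1}]. Off it both sides vanish; on it their difference is the residual. *)
Lemma solves_systemP S : solves_system l d alpha Q S <->
  forall i, [/\ forall j, rx S j i = 0, forall j, ru S j i = 0,
               rxl S i = 0 & rul S i = 0].
Proof.
have Q0 := Q_neq0.
have eqx j : (forall x, fs_at Q (fs_deriv Q (ser_x l alpha S j)) x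
      = - 2 * fs_at Q (fs_mul (ser_x l alpha S j) (ser_u l S j)) x)
    <-> forall i, rx S j i = 0.
  rewrite (@on_grid _ Q0 (-3)) => [|x off]; last first.
    rewrite (fs_off_deriv Q0 (exp_x S j) _ off); last by ring.
    rewrite (fs_off_mul Q0 (exp_x S j) (exp_u S j) _ off); last by ring.
    by rewrite mulr0.
  have E i : fs_at Q (fs_deriv Q (ser_x l alpha S j)) (-3 + i%:R * Q)
      + 2 * fs_at Q (fs_mul (ser_x l alpha S j) (ser_u l S j)) (-3 + i%:R * Q)
      = rx S j i.
    rewrite (@fs_at_deriv _ _ Q0 _ _ _ i _ (exp_x S j)); last by ring.
    rewrite (@fs_at_mul _ _ Q0 _ _ _ _ _ _ i _ (exp_x S j) (exp_u S j)); last by ring.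
    by rewrite (ratr_exp (-2)) /res_x; congr (_ * _ + _); ring.
  split=> H i; have := H i; rewrite -E.
    by move=> ->; ring.
  by move/eqP; rewrite addr_eq0 mulNr => /eqP.
have equ j : (forall x, fs_at Q (fs_deriv Q (ser_u l S j)) x
        = - fs_at Q (fs_mul (ser_u l S j) (ser_ulast S)) x
          + (d j)%:R^-1 * fs_at Q (ser_x l alpha S j) x)
    <-> forall i, ru S j i = 0.
  rewrite (@on_grid _ Q0 (-2)) => [|x off]; last first.
    rewrite (fs_off_deriv Q0 (exp_u S j) _ off); last by ring.
    rewrite (fs_off_mul Q0 (exp_u S j) (exp_ulast S) _ off); last by ring.
    by rewrite (fs_at_off Q0 (exp_x S j) off) mulr0 oppr0 addr0.
  have E i : fs_at Q (fs_deriv Q (ser_u l S j)) (-2 + i%:R * Q)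
      - (- fs_at Q (fs_mul (ser_u l S j) (ser_ulast S)) (-2 + i%:R * Q)
          + (d j)%:R^-1 * fs_at Q (ser_x l alpha S j) (-2 + i%:R * Q))
      = ru S j i.
    rewrite (@fs_at_deriv _ _ Q0 _ _ _ i _ (exp_u S j)); last by ring.
    rewrite (@fs_at_mul _ _ Q0 _ _ _ _ _ _ i _ (exp_u S j) (exp_ulast S)); last by ring.
    rewrite (@fs_at_ser _ _ Q0 _ _ _ i _ (exp_x S j)); last by ring.
    by rewrite conv_shift0r (ratr_exp (-1)) /res_u /us /xs /=; ring.
  split=> H i; have := H i; rewrite -E.
    by move=> ->; ring.
  by move/eqP; rewrite subr_eq0 => /eqP.
have eqxl : (forall x, fs_at Q (fs_deriv Q (ser_xlast S)) x
        = fs_at Q (fs_mul (ser_xlast S) (ser_ulast S)) x)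
    <-> forall i, rxl S i = 0.
  rewrite (@on_grid _ Q0 0) => [|x off]; last first.
    rewrite (fs_off_deriv Q0 (exp_xlast S) _ off); last by ring.
    by rewrite (fs_off_mul Q0 (exp_xlast S) (exp_ulast S) _ off) //; ring.
  have E i : fs_at Q (fs_deriv Q (ser_xlast S)) (0 + i%:R * Q)
        - fs_at Q (fs_mul (ser_xlast S) (ser_ulast S)) (0 + i%:R * Q) = rxl S i.
    rewrite (@fs_at_deriv _ _ Q0 _ _ _ i _ (exp_xlast S)); last by ring.
    rewrite (@fs_at_mul _ _ Q0 _ _ _ _ _ _ i _ (exp_xlast S) (exp_ulast S));
      last by ring.
    by rewrite conv_shift0r conv_shift0l shift0 (ratr_exp 1) /rxl /=; ring.
  split=> H i; have := H i; rewrite -E.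
    by move=> ->; ring.
  by move/eqP; rewrite subr_eq0 => /eqP.
have equl : (forall x, fs_at Q (fs_deriv Q (ser_ulast S)) x
        = - \sum_k (d k)%:R * fs_at Q (fs_mul (ser_u l S k) (ser_u l S k)) x)
    <-> forall i, rul S i = 0.
  rewrite (@on_grid _ Q0 (-2)) => [|x off]; last first.
    rewrite (fs_off_deriv Q0 (exp_ulast S) _ off); last by ring.
    rewrite big1 ?oppr0 // => k _.
    by rewrite (fs_off_mul Q0 (exp_u S k) (exp_u S k) _ off) ?mulr0 //; ring.
  have E i : fs_at Q (fs_deriv Q (ser_ulast S)) (-2 + i%:R * Q)
      + \sum_k (d k)%:R * fs_at Q (fs_mul (ser_u l S k) (ser_u l S k)) (-2 + i%:R * Q)
      = rul S i.
    rewrite (@fs_at_deriv _ _ Q0 _ _ _ i _ (exp_ulast S)); last by ring.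
    rewrite shift0 (ratr_exp (-1)) /res_ulast; congr (_ + _); first by rewrite /=; ring.
    apply: eq_bigr => k _; congr (_ * _).
    by rewrite (@fs_at_mul _ _ Q0 _ _ _ _ _ _ i _ (exp_u S k) (exp_u S k)) //; ring.
  split=> H i; have := H i; rewrite -E.
    by move=> ->; rewrite addNr.
  by move/eqP; rewrite addr_eq0 => /eqP.
split=> H.
  move=> i; split=> [j|j||].
  - by apply: (proj1 (eqx j) _ i) => x; case: (H x).
  - by apply: (proj1 (equ j) _ i) => x; case: (H x).
  - by apply: (proj1 eqxl _ i) => x; case: (H x).
  - by apply: (proj1 equl _ i) => x; case: (H x).
move=> x; split=> [j|j||].
- by apply: (proj2 (eqx j) _ x) => i; case: (H i).
- by apply: (proj2 (equ j) _ x) => i; case: (H i).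
- by apply: (proj2 eqxl _ x) => i; case: (H i).
- by apply: (proj2 equl _ x) => i; case: (H i).
Qed.

(** The constant 1 sits at exponent [0 = -2 + N Q], hence at index [N]. *)
Lemma on_H0P S : on_H0 l d alpha Q S <-> forall i, en S i + (i == N)%:R = 0.
Proof.
have Q0 := Q_neq0.
have exp1 : fs_exp (@fs_one K) = -2 + N%:R * Q by rewrite /= hN; ring.
rewrite /on_H0 (@on_grid _ Q0 (-2)) => [|x off]; last first.
  rewrite (fs_off_mul Q0 (exp_ulast S) (exp_ulast S) _ off); last by ring.
  rewrite (fs_at_off Q0 exp1 off) !big1 ?subr0 ?addr0 // => k _.
    by rewrite (fs_at_off Q0 (exp_x S k) off).
  by rewrite (fs_off_mul Q0 (exp_u S k) (exp_u S k) _ off) ?mulr0 //; ring.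
suff E i : \sum_k (d k)%:R * fs_at Q (fs_mul (ser_u l S k) (ser_u l S k)) (-2 + i%:R * Q)
    - fs_at Q (fs_mul (ser_ulast S) (ser_ulast S)) (-2 + i%:R * Q)
    + \sum_k fs_at Q (ser_x l alpha S k) (-2 + i%:R * Q)
    + fs_at Q fs_one (-2 + i%:R * Q) = en S i + (i == N)%:R.
  by split=> H i; have := H i; rewrite E.
congr (_ - _ + _ + _).
- apply: eq_bigr => k _; congr (_ * _).
  by rewrite (@fs_at_mul _ _ Q0 _ _ _ _ _ _ i _ (exp_u S k) (exp_u S k)) //; ring.
- rewrite (@fs_at_mul _ _ Q0 _ _ _ _ _ _ i _ (exp_ulast S) (exp_ulast S)); last by ring.
  by rewrite conv_shift0r conv_shift0l.
- by apply: eq_bigr => k _; rewrite (@fs_at_ser _ _ Q0 _ _ _ i _ (exp_x S k)) //; ring.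
rewrite (@fs_at_ser _ _ Q0 _ _ _ i _ exp1) //= /shift.
have [lt_iN | le_Ni] := ltnP i N; first by rewrite ltn_eqF.
by rewrite subn_eq0 eqn_leq le_Ni andbT.
Qed.

Lemma ratr_iQ (i : nat) : ratr (i%:R * Q) = i%:R * q :> K.
Proof. by rewrite rmorphM /= ratr_nat. Qed.

(** * Residuals of expansions with the prescribed leading terms *)

Section Leading.
Variable S : coefs K r.
Hypothesis leadS : leading l d alpha a0 b0 S.

Lemma res_x_below j i : (i < shift_x j)%N -> rx S j i = 0.
Proof.
move=> lt_i; rewrite /res_x /xs shift_lt // mulr0 add0r convC conv_shiftr.
by rewrite shift_lt // mulr0.
Qed.

Lemma res_u_below j i : (i < shift_u j)%N -> ru S j i = 0.
Proof.
rewrite /shift_u; case: ifP => // ge_jl lt_i; rewrite /res_u /us /xs.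
rewrite convC conv_shiftr /shift_u /shift_x ge_jl !shift_lt //.
by rewrite !mulr0 addr0 subr0.
Qed.

(** On the common grid [a_{j,i}] sits at index [i + shift_x j], so this is the residual belonging to
    step [i]. *)
Lemma res_xE j i : rx S j (i + shift_x j)%N =
  (i%:R * q + (if (j < l)%N then ratr (alpha j) else 0)) * ca S j i
  + 2 * shift (shift_u j) (conv (ca S j) (cc S j)) i.
Proof.
rewrite /res_x /xs /us conv_shift shiftDr.
rewrite [(shift_x j + _)%N]addnC shiftD natrD; congr (_ * _ + _).
case: ifP => lt_jl; last by rewrite /shift_x lt_jl mulrDl Nq; ring.
by rewrite alpha_shift // (ratr_exp (-2)); ring.
Qed.

Lemma res_uE j i : ru S j (i + shift_u j)%N =
  (i%:R * q + (if (j < l)%N then -1 else 1)) * cc S j i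
  + conv (cc S j) (ce S) i
  - (d j)%:R^-1 * (if (j < l)%N then shift (shift_x j) (ca S j) i else ca S j i).
Proof.
rewrite /res_u /us /xs convC conv_shiftr !shiftDr convC natrD.
congr (_ * _ + _ - _ * _); rewrite /shift_u /shift_x.
  by case: ifP => _; rewrite ?addr0 ?mulrDl ?Nq; ring.
by case: ifP => _; rewrite ?addn0 ?shiftDr.
Qed.

Lemma res_ulastE i : rul S i = (i%:R * q - 1) * ce S i
  + \sum_(j < r | (j < l)%N) (d j)%:R * conv (cc S j) (cc S j) i
  + \sum_(j < r | ~~ (j < l)%N)
      (d j)%:R * shift (N + N) (conv (cc S j) (cc S j)) i.
Proof.
rewrite /res_ulast (bigID (fun j : 'I_r => (j < l)%N)) /= -addrA.
congr (_ + (_ + _)); apply: eq_bigr => j lt_jl; rewrite /us conv_shift /shift_u.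
  by rewrite lt_jl shift0.
by rewrite (negPf lt_jl).
Qed.

(** The choice of [c0] and [e_0 = 1] solves the equations at lowest order. For [j < l] the term in
    [x_j] does not reach the lowest order of the [u_j] equation, because [shift_x j > 0]. *)
Lemma leading_residuals : [/\ forall j, rx S j (shift_x j) = 0,
  forall j, ru S j (shift_u j) = 0, rxl S 0 = 0 & rul S 0 = 0].
Proof.
have [lead_a lead_b lead_c lead_e] := leadS; split=> [j|j||].
- rewrite -[shift_x j]add0n res_xE /shift_u; case: (boolP (j < l)%N) => lt_jl.
    by rewrite shift0 conv0 lead_a lead_c /Defs.c0 lt_jl; field.
  by rewrite shift_lt ?N_gt0 //; ring.
- rewrite -[shift_u j]add0n res_uE conv0 lead_c lead_e lead_a /Defs.c0.
  case: (boolP (j < l)%N) => lt_jl; first by rewrite shift_lt ?shift_x_gt0 //; ring.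
  by field; rewrite d_neq0.
- by rewrite /rxl conv0 lead_e; ring.
rewrite res_ulastE lead_e [X in _ + _ + X]big1 => [|j _]; last first.
  by rewrite shift_lt ?mulr0 // addn_gt0 N_gt0.
under eq_bigr => j _ do rewrite conv0 lead_c mulrA.
by rewrite (sum_c0_sq a0 hell); ring.
Qed.

Lemma shift_sum (f g : nat -> K) n i :
  \sum_(0 <= k < (i.+1 - n)%N) f (i - n - k)%N * g k = shift n (conv f g) i.
Proof.
rewrite /shift; have [lt_in | le_ni] := ltnP i n; last by rewrite subSn.
by rewrite (eqP (_ : i.+1 - n == 0)%N) ?subn_eq0 // big_geq.
Qed.

Lemma res_x_step j i : (0 < i)%N ->
  rx S j (i + shift_x j)%N = ratr (i%:R * Q) * ca S j i
    + (if (j < l)%N then 2 * a0 j * cc S j i else 0) - rhs_a l N S j i.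
Proof.
have [lead_a _ lead_c _] := leadS => i_gt0.
rewrite res_xE ratr_iQ /rhs_a /shift_u.
case: (boolP (j < l)%N) => lt_jl; last by rewrite shift_sum; ring.
by rewrite shift0 conv_ends // lead_a lead_c /Defs.c0 lt_jl; field.
Qed.

Lemma res_u_step j i : (0 < i)%N ->
  ru S j (i + shift_u j)%N =
    (if (j < l)%N then ratr (i%:R * Q) * cc S j i
     else - (d j)%:R^-1 * ca S j i + (ratr (i%:R * Q) + 2) * cc S j i)
    + c0 j * ce S i - rhs_c l d s S j i.
Proof.
have [_ _ lead_c lead_e] := leadS => i_gt0.
rewrite res_uE ratr_iQ /rhs_c conv_ends // lead_e lead_c.
case: (boolP (j < l)%N) => lt_jl; last by ring.
suff -> : zcoef (ca S j) (i%:Z - s j) = shift (shift_x j) (ca S j) i by ring.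
rewrite (shift_xE lt_jl) /shift; have [lt_i | le_i] := ltnP i (shift_x j).
  by have -> : i%:Z - (shift_x j)%:Z = Negz (shift_x j - i).-1 by lia.
by rewrite subzn.
Qed.

Lemma res_xlast_step i : (0 < i)%N ->
  rxl S i = ratr (i%:R * Q) * cb S i - b0 * ce S i - rhs_b S i.
Proof.
have [_ lead_b _ lead_e] := leadS => i_gt0.
by rewrite /rxl ratr_iQ /rhs_b conv_ends // lead_b lead_e; ring.
Qed.

Lemma res_ulast_step i : (0 < i)%N ->
  rul S i = 2 * (\sum_(j < r | (j < l)%N) (d j)%:R * c0 j * cc S j i)
    + (ratr (i%:R * Q) - 1) * ce S i - rhs_e l d N S i.
Proof.
have [_ _ lead_c _] := leadS => i_gt0.
rewrite res_ulastE ratr_iQ /rhs_e mul2n -addnn.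
rewrite [X in _ - (_ - X)](eq_bigr (fun j : 'I_r => (d j)%:R *
   shift (N + N) (conv (cc S j) (cc S j)) i)); last first.
  by move=> j _; rewrite shift_sum.
rewrite [X in _ + X + _](eq_bigr (fun j : 'I_r => 2 * ((d j)%:R * c0 j * cc S j i)
   + (d j)%:R * \sum_(1 <= k < i) cc S j (i - k)%N * cc S j k)); last first.
  by move=> j _; rewrite conv_ends // lead_c; ring.
by rewrite big_split /= -mulr_sumr; ring.
Qed.

(** Splitting the two end terms off each convolution turns the residual into left-hand side minus
    right-hand side of the linear system. *)
Lemma solves_stepP i : (0 < i)%N ->
  solves_step l d alpha Q a0 b0 s N S i <->
  [/\ forall j, rx S j (i + shift_x j)%N = 0,
      forall j, ru S j (i + shift_u j)%N = 0, rxl S i = 0 & rul S i = 0].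
Proof.
move=> i_gt0.
rewrite /solves_step (Xmat_stack l d alpha a0 b0 _ (ca S ^~ i) _ (cc S ^~ i)).
split=> [/stack_inj[Ra Rb Rc Re] | [Ra Rc Rb Re]].
  split=> [j|j||].
  - by rewrite res_x_step //; apply/eqP; rewrite subr_eq0; apply/eqP; exact: Ra.
  - by rewrite res_u_step //; apply/eqP; rewrite subr_eq0; apply/eqP; exact: Rc.
  - by rewrite res_xlast_step // Rb subrr.
  - by rewrite res_ulast_step // Re subrr.
apply/stack_inj; split=> [j||j|]; apply/eqP; rewrite -subr_eq0.
- by rewrite -res_x_step // Ra.
- by rewrite -res_xlast_step // Rb.
- by rewrite -res_u_step // Rc.
- by rewrite -res_ulast_step // Re.
Qed.

Section Steps.
Variable n : nat.
Hypothesis stepS : forall i, (0 < i < n)%N ->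
  solves_step l d alpha Q a0 b0 s N S i.

Lemma step_residuals i : (i < n)%N ->
  [/\ forall j, rx S j (i + shift_x j)%N = 0,
      forall j, ru S j (i + shift_u j)%N = 0, rxl S i = 0 & rul S i = 0].
Proof.
case: i => [_ | i lt_in]; last by apply/solves_stepP => //; apply: stepS.
by case: leading_residuals => R1 R2 R3 R4; split=> // j; rewrite add0n.
Qed.

(** The range exceeds [n] by [shift_x j > 0], so the steps before [N] already control the [x_j]
    residual at index [N]. *)
Lemma res_x_eq0 j i : (i < n + shift_x j)%N -> rx S j i = 0.
Proof.
have [/res_x_below // | le_i lt_i] := ltnP i (shift_x j).
rewrite -(subnK le_i); have [] := @step_residuals (i - shift_x j) => //.
by rewrite ltn_subLR // addnC.
Qed.

Lemma res_u_eq0 j i : (i < n)%N -> ru S j i = 0.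
Proof.
have [/res_u_below // | le_i lt_i] := ltnP i (shift_u j).
rewrite -(subnK le_i); have [] := @step_residuals (i - shift_u j) => //.
by rewrite (leq_ltn_trans (leq_subr _ _)).
Qed.

End Steps.

Lemma solves_steps_system :
  (forall i, (0 < i)%N -> solves_step l d alpha Q a0 b0 s N S i) ->
  solves_system l d alpha Q S.
Proof.
move=> stepS; have stepS_lt n i : (0 < i < n)%N ->
    solves_step l d alpha Q a0 b0 s N S i by case/andP=> /stepS.
apply/solves_systemP => i.
have [_ _ Rxl Rul] := step_residuals (stepS_lt i.+1) (ltnSn i).
split=> // j; first by rewrite (res_x_eq0 (stepS_lt i.+1)) // ltn_addr.
exact: (res_u_eq0 (stepS_lt i.+1)).
Qed.

(** For [j >= l] the series [u_j] starts [N] places later on the common grid, so these indices drop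
    out of the pairing at the top resonance. *)
Lemma us0 j : us S j 0 = if (j < l)%N then c0 j else 0.
Proof.
have [_ _ lead_c _] := leadS; rewrite /us /shift_u.
by case: ifP => _; rewrite ?shift0 // shift_lt // N_gt0.
Qed.

(* Before step [N] all residuals vanish, so the coefficient of index [N] of    *)
(* the derivative of the first integral, which carries the factor              *)
(* [NQ - 2 = 0], is a combination of the residuals of step [N] alone; this     *)
(* combination is the cokernel condition for [X(2)].                           *)
Lemma top_compatibility :
  (forall i, (0 < i < N)%N -> solves_step l d alpha Q a0 b0 s N S i) ->
  \sum_(j < r | (j < l)%N) (d j)%:R * c0 j * rhs_c l d s S j N
  = rhs_e l d N S N.
Proof.
move=> stepS; have [_ _ _ lead_e] := leadS; have N_pos := N_gt0.
have := first_integral q d_neq0 (xs S) (us S) (ce S) N.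
rewrite Nq subrr mul0r conv_vanish => [|k lt_kN]; last first.
  by case: (step_residuals stepS lt_kN).
(* The [x_k] residuals vanish at index [N], and of each convolution only the leading coefficient
   times the residual at [N] survives. *)
have -> : \sum_k (2 * (d k)%:R * conv (us S k) (ru S k) N + rx S k N) =
    2 * \sum_(k < r | (k < l)%N) (d k)%:R * c0 k * ru S k (N + shift_u k)%N.
  rewrite mulr_sumr [RHS]big_mkcond; apply: eq_bigr => k _.
  rewrite (res_x_eq0 stepS) ?addr0; last first.
    by rewrite -[X in (X < _)%N]addn0 ltn_add2l shift_x_gt0.
  rewrite conv_vanish => [|m lt_mN]; last exact: (res_u_eq0 stepS).
  rewrite us0; case: ifP => lt_kl; last by ring.
  by rewrite /shift_u lt_kl addn0; ring.
rewrite lead_e mul1r res_ulast_step // ratr_iQ Nq.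
have -> : \sum_(k < r | (k < l)%N) (d k)%:R * c0 k * ru S k (N + shift_u k)%N =
    2 * (\sum_(k < r | (k < l)%N) (d k)%:R * c0 k * cc S k N) + ce S N
    - \sum_(j < r | (j < l)%N) (d j)%:R * c0 j * rhs_c l d s S j N.
  (* [sum_c0_sq] spreads [ce S N] over the sum, to match the terms [c0 k * ce S N] of the [u_k]
     rows. *)
  have -> : ce S N = \sum_(k < r | (k < l)%N) ce S N * ((d k)%:R * c0 k * c0 k).
    by rewrite -mulr_sumr (sum_c0_sq a0 hell) mulr1.
  rewrite mulr_sumr -big_split -sumrB /=; apply: eq_bigr => k lt_kl.
  by rewrite res_u_step // lt_kl ratr_iQ Nq; ring.
set B := \sum_(j < r | _) _ * rhs_c l d s S _ N => E.
have : 2 * (rhs_e l d N S N - B) = 0 by rewrite [RHS]E; ring.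
by move/eqP; rewrite mulf_eq0 pnatr_eq0 /= subr_eq0 => /eqP ->.
Qed.

(** The part of [F_N] built from coefficients of index below [N]; [xs T j N] qualifies because
    [shift_x j > 0]. *)
Definition energy_below (T : coefs K r) : K :=
  \sum_(j < r | (j < l)%N)
     (d j)%:R * \sum_(1 <= k < N) cc T j (N - k)%N * cc T j k
  - \sum_(1 <= k < N) ce T (N - k)%N * ce T k + \sum_j xs T j N.

(** The squares [u_j^2] with [j >= l] start at index [2N > N] and do not contribute; for the others
    the end terms of the convolution are isolated. *)
Lemma energy_top : en S N = energy_below S
  + 2 * (\sum_(j < r | (j < l)%N) (d j)%:R * c0 j * cc S j N) - 2 * ce S N.
Proof.
have [_ _ lead_c lead_e] := leadS; have N_pos := N_gt0.
rewrite /energy /energy_below [conv (ce S) _ _]conv_ends // lead_e.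
rewrite (bigID (fun j : 'I_r => (j < l)%N)) /= [X in _ + X - _]big1; last first.
  move=> j ge_jl; rewrite /us conv_shift /shift_u (negPf ge_jl).
  by rewrite shift_lt ?mulr0 // -[X in (X < _)%N]addn0 ltn_add2l.
rewrite (eq_bigr (fun j : 'I_r => 2 * ((d j)%:R * c0 j * cc S j N)
   + (d j)%:R * \sum_(1 <= k < N) cc S j (N - k)%N * cc S j k)); last first.
  move=> j lt_jl; rewrite /us conv_shift /shift_u lt_jl shift0 conv_ends //.
  by rewrite lead_c; ring.
by rewrite big_split /= -mulr_sumr; ring.
Qed.

End Leading.

(** * Dependence on earlier coefficients *)

Lemma unknowns_inj S T i : unknowns S i = unknowns T i <->
  [/\ forall j, ca S j i = ca T j i, cb S i = cb T i,
      forall j, cc S j i = cc T j i & ce S i = ce T i].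
Proof.
exact: (stack_inj (ca S ^~ i) _ (cc S ^~ i) _ (ca T ^~ i) _ (cc T ^~ i)).
Qed.

Section Agreement.
Variables (S T : coefs K r) (i : nat).
Hypothesis agree : forall k, (k < i)%N -> unknowns S k = unknowns T k.

Let agree_a j k : (k < i)%N -> ca S j k = ca T j k.
Proof. by move/agree/unknowns_inj => []. Qed.
Let agree_b k : (k < i)%N -> cb S k = cb T k.
Proof. by move/agree/unknowns_inj => []. Qed.
Let agree_c j k : (k < i)%N -> cc S j k = cc T j k.
Proof. by move/agree/unknowns_inj => []. Qed.
Let agree_e k : (k < i)%N -> ce S k = ce T k.
Proof. by move/agree/unknowns_inj => []. Qed.

(** Only indices below [i] occur, since [s j > 0] and [N > 0]. This makes the recursion on steps
    well founded. *)
Lemma rhs_ext : rhs l d s N S i = rhs l d s N T i.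
Proof.
have N_pos := N_gt0; apply/stack_inj; split=> [j||j|].
- rewrite /rhs_a; case: ifP => _; congr (_ * _); apply: eq_big_nat => k lt_k.
    by rewrite agree_a ?agree_c //; lia.
  by rewrite agree_a ?agree_c //; lia.
- by apply: eq_big_nat => k lt_k; rewrite agree_b ?agree_e //; lia.
- rewrite /rhs_c; congr (- _ + _).
    by apply: eq_big_nat => k lt_k; rewrite agree_c ?agree_e //; lia.
  case: ifP => // lt_jl; congr (_ * _).
  have := s_gt0 lt_jl; rewrite /zcoef.
  case E: (i%:Z - s j) => [n|n] // s_pos; rewrite agree_a //; lia.
rewrite /rhs_e; congr (- _ - _); apply: eq_bigr => j _; congr (_ * _);
  by apply: eq_big_nat => k lt_k; rewrite !agree_c //; lia.
Qed.

Lemma energy_below_ext : i = N -> energy_below S = energy_below T.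
Proof.
have N_pos := N_gt0; move=> def_i; rewrite /energy_below; congr (_ - _ + _).
- apply: eq_bigr => j _; congr (_ * _); apply: eq_big_nat => k lt_k.
  by rewrite !agree_c //; lia.
- by apply: eq_big_nat => k lt_k; rewrite !agree_e //; lia.
apply: eq_bigr => j _; have := shift_x_gt0 j => sh_gt0.
by rewrite /xs /shift; case: ifP => // _; rewrite agree_a //; lia.
Qed.

Lemma leading_ext : (0 < i)%N -> leading l d alpha a0 b0 S ->
  leading l d alpha a0 b0 T.
Proof.
move=> i_gt0 [lead_a lead_b lead_c lead_e].
by split=> [j||j|]; rewrite -(agree_a, agree_b, agree_c, agree_e).
Qed.

End Agreement.

(** * Existence of formal solutions *)

Lemma nonresonant i : (0 < i)%N -> i != N ->
  Xmat l d alpha a0 b0 (ratr (i%:R * Q)) \in unitmx.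
Proof.
move=> i_gt0 i_neqN.
have pos : 0 < ratr (i%:R * Q) :> K by rewrite ltr0q mulr_gt0 ?Q_gt0 // ltr0n.
apply: (Xmat_unit _ _ hell).
- by rewrite gt_eqF.
- by rewrite gt_eqF // (lt_trans _ pos) // oppr_lt0 ltr01.
- by rewrite gt_eqF // (lt_trans _ pos) // oppr_lt0 ltr0n.
(* Writing 2 as [N q], the value [iota = 2] would force [i = N]. *)
rewrite ratr_iQ -Nq (inj_eq (mulIf _)) ?eqr_nat //.
by rewrite fmorph_eq0 Q_neq0.
Qed.

Lemma exists_solves_before :
  exists S : coefs K r, solves_before l d alpha Q a0 b0 s N S.
Proof.
(* From index [N] on, where the matrix is singular, the values are junk; only the steps before [N]
   are claimed. *)
pose step i v := if i == 0%N then stack a0 b0 c0 1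
  else invmx (Xmat l d alpha a0 b0 (ratr (i%:R * Q)))
       *m rhs l d s N (unstack v) i.
have [i v v' eq_v | v def_v] := @strong_recursion _ 0 step.
  rewrite /step; case: ifP => // _; congr (_ *m _); apply: rhs_ext => k lt_ki.
  by rewrite !unknowns_unstack eq_v.
exists (unstack v); split=> [|i /andP[i_gt0 lt_iN]].
  have := unknowns_unstack v 0; rewrite def_v /step eqxx.
  by move/(@stack_inj K r (ca (unstack v) ^~ 0%N) _ (cc (unstack v) ^~ 0%N)) => [].
rewrite /solves_step unknowns_unstack def_v /step gtn_eqF //.
by rewrite mulKVmx // nonresonant // ltn_eqF.
Qed.

(** Keep [S] below [N], insert [v] at [N], and invert the nonsingular systems beyond. *)
Lemma exists_continuation S v : solves_before l d alpha Q a0 b0 s N S ->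
  Xmat l d alpha a0 b0 2 *m v = rhs l d s N S N ->
  exists T, continuation l d alpha Q N S v T.
Proof.
case=> leadS stepS Xv; have N_pos := N_gt0.
pose step i w := if (i < N)%N then unknowns S i else if i == N then v
  else invmx (Xmat l d alpha a0 b0 (ratr (i%:R * Q)))
       *m rhs l d s N (unstack w) i.
have [i w w' eq_w | w def_w] := @strong_recursion _ 0 step.
  rewrite /step; do 2!case: ifP => // _; congr (_ *m _).
  by apply: rhs_ext => k lt_ki; rewrite !unknowns_unstack eq_w.
have T_lt i : (i < N)%N -> unknowns (unstack w) i = unknowns S i.
  by move=> lt_iN; rewrite unknowns_unstack def_w /step lt_iN.
have S_lt i : (i < N)%N -> unknowns S i = unknowns (unstack w) i.
  by move/T_lt.
have T_N : unknowns (unstack w) N = v.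
  by rewrite unknowns_unstack def_w /step ltnn eqxx.
exists (unstack w); split=> //; apply: solves_steps_system.
  exact: (leading_ext S_lt).
move=> i i_gt0; rewrite /solves_step; case: (ltngtP i N) => [lt_iN | gt_iN | ->].
- rewrite T_lt // (stepS i) ?i_gt0 //; apply: rhs_ext => k lt_ki.
  by apply: S_lt; apply: ltn_trans lt_iN.
- rewrite {1}unknowns_unstack def_w /step ltnNge ltnW //= gtn_eqF //.
  by rewrite mulKVmx // nonresonant // gtn_eqF.
by rewrite T_N ratr_iQ Nq Xv; apply: rhs_ext.
Qed.

(** * Energy of a solution and choice of the free parameter *)

Lemma energy_solution T i : solves_system l d alpha Q T ->
  (i%:R * q - 2) * en T i = 0.
Proof.
move/solves_systemP => R; rewrite first_integral; last exact: d_neq0.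
rewrite big1 => [|k _].
  rewrite conv_vanish => [|k _]; last by case: (R k).
  by case: (R i) => _ _ _ ->; rewrite !mulr0 subrr.
rewrite conv_vanish => [|m _]; last by case: (R m).
by case: (R i) => -> -> _ _; rewrite !mulr0 addr0.
Qed.

Theorem top_resonance_analysis :
  [/\ top_resonance l d alpha a0 b0 2,
      exists S : coefs K r, solves_before l d alpha Q a0 b0 s N S
    & forall S : coefs K r, solves_before l d alpha Q a0 b0 s N S ->
        compatible l d alpha a0 b0 s N S /\
        exists p w, top_parametrization l d alpha a0 b0 s N S p w /\
        exists lambda : K,
          (exists T, continuation l d alpha Q N S (p + lambda *: w) T) /\
          (forall T, continuation l d alpha Q N S (p + lambda *: w) T ->
             on_H0 l d alpha Q T)].
Proof.
have N_pos := N_gt0.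
split; [exact: top_resonance2 | exact: exists_solves_before | move=> S befS].
have [leadS stepS] := befS.
have [p Xp] : compatible l d alpha a0 b0 s N S.
  exact: (@Xmat2_solvable _ _ _ _ _ _ _ hd (rhs_a l N S ^~ N) (rhs_b S N)
            (rhs_c l d s S ^~ N) _ (top_compatibility leadS stepS)).
pose w := top_kernel l d alpha a0 b0.
have Xw : Xmat l d alpha a0 b0 2 *m w = 0 by apply: Xmat2_top_kernel.
have Xpw lambda : Xmat l d alpha a0 b0 2 *m (p + lambda *: w) = rhs l d s N S N.
  by rewrite mulmxDr -scalemxAr Xw scaler0 addr0.
split; first by exists p.
exists p, w; split.
  split=> [|v]; first exact/eqP/top_kernel_neq0.
  split=> [Xv | [lambda ->] //].
  have [|lambda def_v] := @Xmat2_kernel _ _ l d alpha a0 b0 (v - p).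
    by rewrite mulmxBr Xv Xp subrr.
  by exists lambda; rewrite -def_v addrC subrK.
have [pa [pb [pc [pe def_p]]]] := stackP p.
(* The energy at step [N] is affine in [lambda] with slope [-3]. *)
pose lambda := (energy_below S
  + 2 * (\sum_(j < r | (j < l)%N) (d j)%:R * c0 j * pc j) - 2 * pe + 1) / 3.
exists lambda; split; first exact: exists_continuation.
move=> T [T_lt T_N solT].
have S_lt i : (i < N)%N -> unknowns S i = unknowns T i by move/T_lt.
have leadT := leading_ext S_lt N_pos leadS.
apply/on_H0P => i; have [-> | i_neqN] := eqVneq i N; last first.
  have /eqP := energy_solution i solT; rewrite mulf_eq0 addr0.
  rewrite subr_eq0 -[2]Nq (inj_eq (mulIf _)) ?eqr_nat; last first.
    by rewrite fmorph_eq0 Q_neq0.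
  by rewrite (negPf i_neqN) => /eqP.
rewrite energy_top // -(energy_below_ext S_lt) //.
move: T_N; rewrite def_p stack_combine.
move/(@stack_inj K r (ca T ^~ N) _ (cc T ^~ N)) => [_ _ Tc ->].
(* Along [w] each [c j] changes by [- lambda * c0 j / 2] and [e] by [lambda], so [F_N] changes by
   [- lambda - 2 * lambda]. *)
have -> : \sum_(j < r | (j < l)%N) (d j)%:R * c0 j * cc T j N =
    \sum_(j < r | (j < l)%N) (d j)%:R * c0 j * pc j - lambda / 2.
  have -> : lambda / 2 =
      \sum_(j < r | (j < l)%N) lambda / 2 * ((d j)%:R * c0 j * c0 j).
    by rewrite -mulr_sumr (sum_c0_sq a0 hell) mulr1.
  rewrite -sumrB; apply: eq_bigr => j lt_jl.
  by rewrite [cc T j N]Tc lt_jl; ring.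
by rewrite /= /lambda; field.
Qed.

End Expansion.

(** * Specialization to complex coefficients *)

Theorem proposition4p7 (R : realType) (r l : nat) (d : 'I_r -> nat)
  (alpha : 'I_r -> rat) (Q : rat) (s : 'I_r -> int) (N : nat)
  (a0 : 'I_r -> R[i]) (b0 : R[i])
  (hr : (2 <= r)%N) (hl : (1 <= l <= r)%N)
  (hd : forall j, (2 <= d j)%N)
  (halpha : forall j : 'I_r, (j < l)%N -> alpha j != 0)
  (hell : \sum_(j < r | (j < l)%N) (d j)%:R * alpha j ^+ 2 = 4)
  (hQ : is_gcd_step l alpha Q)
  (hs : forall j : 'I_r, (j < l)%N -> alpha j = - 2 + (s j)%:~R * Q)
  (hN : N%:R * Q = 2)
  (ha0 : forall j, a0 j != 0) (hb0 : b0 != 0) :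
  [/\ top_resonance l d alpha a0 b0 2,
      exists S : coefs R[i] r, solves_before l d alpha Q a0 b0 s N S
    & forall S : coefs R[i] r, solves_before l d alpha Q a0 b0 s N S ->
        compatible l d alpha a0 b0 s N S /\
        exists p w, top_parametrization l d alpha a0 b0 s N S p w /\
        exists lambda : R[i],
          (exists T, continuation l d alpha Q N S (p + lambda *: w) T) /\
          (forall T, continuation l d alpha Q N S (p + lambda *: w) T ->
             on_H0 l d alpha Q T)].
Proof. exact: (top_resonance_analysis a0 b0 hd hell hs hN). Qed.
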